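(* For every angle $\theta\in\mathbb{R}$, letting $\ket{R_\theta}=2^{-1/2}(\ket{0}+e^{i\theta}\ket{1})$, we have $\chi(R_\theta^{\otimes m}) = O(2^{m/2})$ as $m\to\infty$.
   Context: An $n$-qubit stabilizer state is a state of the form $C\ket{0^n}$ with $C$ an $n$-qubit Clifford unitary. The stabilizer rank $\chi(\psi)$ of an $n$-qubit state $\ket{\psi}$ is the minimum $k$ such that $\ket{\psi}=\sum_{i=1}^k c_i\ket{\Phi_i}$ with $c_i\in\mathbb{C}$ and $\ket{\Phi_i}$ stabilizer states. $R_\theta^{\otimes m}$ denotes the state $\ket{R_\theta}^{\otimes m}$. *)

(* Defs.v *)
From HB Require Import structures.
From mathcomp Require Import all_boot all_order all_algebra.
From mathcomp Require Import all_classical all_reals all_analysis.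
From mathcomp Require Import complex.
Set Implicit Arguments. Unset Strict Implicit. Unset Printing Implicit Defensive.
Import GRing.Theory Num.Theory.
Local Open Scope ring_scope.
Local Open Scope complex_scope.

Section Qubits.
Variable R : realType.
Local Notation C := R[i].

(* n-qubit states: column vectors of dimension 2^n; computational basis index
   i : 'I_(2^n) encodes the bit string whose j-th bit is [qbit j i]. *)
Definition qbit (n : nat) (j : 'I_n) (i : 'I_(2 ^ n)) : bool := odd (i %/ 2 ^ j).

Definition adj (n : nat) (U : 'M[C]_n) : 'M[C]_n := map_mx conjc U^T.

Definition unitary (n : nat) (U : 'M[C]_n) : Prop := U *m adj U = 1%:M.

Definition pauli1 (a : 'I_4) (b c : bool) : C :=
  match val a with
  | 0%N => if b == c then 1 else 0
  | 1%N => if b != c then 1 else 0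
  | 2%N => if b == c then 0 else if b then 'i else - 'i
  | _   => if b == c then (if b then -1 else 1) else 0
  end.

(* n-qubit Pauli operator  i^k * (sigma_{a_0} (x) ... (x) sigma_{a_{n-1}}) *)
Definition pauli_op (n : nat) (k : 'I_4) (a : 'I_n -> 'I_4) : 'M[C]_(2 ^ n) :=
  \matrix_(r, s) ('i ^+ k * \prod_(j < n) pauli1 (a j) (qbit j r) (qbit j s)).

Definition pauli_group (n : nat) (P : 'M[C]_(2 ^ n)) : Prop :=
  exists (k : 'I_4) (a : 'I_n -> 'I_4), P = pauli_op k a.

Definition clifford (n : nat) (U : 'M[C]_(2 ^ n)) : Prop :=
  unitary U /\ forall P, pauli_group P -> pauli_group (U *m P *m adj U).

Definition ket0 (n : nat) : 'cV[C]_(2 ^ n) :=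
  \col_i (if val i == 0%N then 1 else 0).

Definition stabilizer_state (n : nat) (phi : 'cV[C]_(2 ^ n)) : Prop :=
  exists U, clifford U /\ phi = U *m ket0 n.

Definition stab_decomp (n : nat) (psi : 'cV[C]_(2 ^ n)) (k : nat) : Prop :=
  exists (c : 'I_k -> C) (Phi : 'I_k -> 'cV[C]_(2 ^ n)),
    (forall i, stabilizer_state (Phi i)) /\ psi = \sum_(i < k) c i *: Phi i.

(* stabilizer rank: the least such k (0 if none exists, which never happens) *)
Definition stab_rank (n : nat) (psi : 'cV[C]_(2 ^ n)) : nat :=
  match pselect (exists k, `[< stab_decomp psi k >]) with
  | left H => ex_minn H
  | right _ => 0%N
  end.

(* |R_theta>^{(x) m}: entry at basis string x is prod_j 2^{-1/2} e^{i theta x_j} *)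
Definition Rtheta1 (theta : R) (b : bool) : C :=
  (Num.sqrt 2)^-1%:C * (if b then cos theta +i* sin theta else 1).

Definition Rtheta_pow (theta : R) (m : nat) : 'cV[C]_(2 ^ m) :=
  \col_i \prod_(j < m) Rtheta1 theta (qbit j i).

End Qubits.

(* Main.v *)
(* Put [w = e^{i theta}]. Up to scaling, [R_theta^{(x) m}] has amplitudes [w ^+ |x|].
   On the six-bit strings of even weight, [w ^+ |y|] is a combination of the four functions
   [1], ['i ^+ |y|], [y = 000000] and [y = 111111], and multiplying amplitudes by any of
   these, evaluated at affine functions of the bits of [x], maps stabilizer states to
   multiples of stabilizer states. Split [x] into blocks of four bits and complete each
   block to an even string by an incoming and an outgoing parity bit, where the incoming
   bit of a block is the negation of the outgoing bit of the previous one. An outgoing bit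
   and its negation contribute [w] together, so [w ^+ |x|] is, up to boundary terms, the
   product over the blocks of [w ^+ |y|]: four stabilizer terms per four qubits. *)

Require Import Defs.
From HB Require Import structures.
From mathcomp Require Import all_boot all_order all_algebra.
From mathcomp Require Import all_classical all_reals all_analysis.
From mathcomp Require Import complex ring.
Set Implicit Arguments. Unset Strict Implicit. Unset Printing Implicit Defensive.
Import GRing.Theory Num.Theory.
Local Open Scope ring_scope.

(** * Binary expansion of basis indices *)

Lemma eq_bits (n x y : nat) : (x < 2 ^ n)%N -> (y < 2 ^ n)%N ->
  (forall j, (j < n)%N -> odd (x %/ 2 ^ j) = odd (y %/ 2 ^ j)) -> x = y.
Proof.
elim: n x y => [|n IHn] x y; first by rewrite expn0 !ltnS !leqn0 => /eqP-> /eqP->.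
rewrite expnS => ltx lty exy.
have e0 : odd x = odd y by have := exy 0%N isT; rewrite expn0 !divn1.
rewrite -(odd_double_half x) -(odd_double_half y) e0; congr (_ + _.*2)%N.
apply: IHn => [||j ltj]; rewrite -?divn2 ?ltn_divLR // 1?mulnC //.
by have := exy j.+1 ltj; rewrite expnS !divnMA.
Qed.

Lemma qbit_inj (n : nat) (x y : 'I_(2 ^ n)) :
  (forall j, qbit j x = qbit j y) -> x = y.
Proof.
move=> exy; apply: val_inj; apply: (eq_bits (ltn_ord x) (ltn_ord y)) => j ltj.
exact: exy (Ordinal ltj).
Qed.

(** Taking bits is injective between sets of equal size, so the sum runs over all bit vectors and
    distributivity applies. *)
Lemma sum_prod_qbit (A : comNzRingType) (n : nat) (f : 'I_n -> bool -> A) :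
  \sum_(x < 2 ^ n) \prod_j f j (qbit j x) = \prod_j (f j true + f j false).
Proof.
pose bits (x : 'I_(2 ^ n)) := [ffun j => qbit j x].
have bij_bits : bijective bits.
  apply: inj_card_bij => [x y /ffunP exy|]; last first.
    by rewrite card_ffun card_bool !card_ord.
  by apply: qbit_inj => j; have := exy j; rewrite !ffunE.
under [RHS]eq_bigr => j _ do rewrite -big_bool.
rewrite bigA_distr_bigA (reindex bits) /=; last exact: onW_bij.
by apply: eq_bigr => x _; apply: eq_bigr => j _; rewrite ffunE.
Qed.

(* The coefficients are chosen to match at the weights 0, 2, 4 and 6. *)
Lemma exp_even6 (F : numClosedFieldType) (w : F) (y : 'I_6 -> bool) :
  \big[addb/false]_i y i = false ->
  (w ^+ 2 + w ^+ 4) / 2 + (w ^+ 4 - w ^+ 2) / 2 * \prod_i 'i ^+ y i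
  + (1 - w ^+ 4) * \prod_i (~~ y i)%:R + (w ^+ 6 - w ^+ 2) * \prod_i (y i)%:R
  = \prod_i w ^+ y i.
Proof.
have i2 : 'i ^+ 2 = -1 :> F := sqrCi F.
rewrite !big_ord_recl !big_ord0 /=.
case: (y _);
  case: (y _); case: (y _); case: (y _); case: (y _); case: (y _) => //= _;
  rewrite ?(expr0, expr1, mulr0, mulr1, mul1r, mul0r, addr0);
  by field: i2.
Qed.

(* [pauli1 R a b c] is nonzero iff [c = b (+) pauli_flip a], and is then
   ['i ^+ pauli_phase a b]. *)
Definition pauli_flip (a : nat) : bool := (a == 1%N) || (a == 2%N).

Definition pauli_phase (a : nat) (b : bool) : nat :=
  (match a with 2 => if b then 1 else 3 | 3 => if b then 2 else 0 | _ => 0 end)%N.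

Section Rank.
Variable R : realType.
Local Notation C := (R[i] : numClosedFieldType).

(** * Tensor products and the Pauli group *)

Section Paulis.
Variable n : nat.
Implicit Types P Q U V : 'M[C]_(2 ^ n).

Lemma prod_eq_qbit (x y : 'I_(2 ^ n)) :
  \prod_j (qbit j x == qbit j y)%:R = (x == y)%:R :> C.
Proof.
case: eqVneq => [->|nexy]; first by rewrite big1 // => j _; rewrite eqxx.
case: (pickP (fun j => qbit j x != qbit j y)) => [j neqj|exy].
  by rewrite (bigD1 j) //= (negbTE neqj) mul0r.
by case/eqP: nexy; apply: qbit_inj => j; apply/eqP; rewrite -[_ == _]negbK exy.
Qed.

Lemma adjM U V : adj (U *m V) = adj V *m adj U.
Proof. by rewrite /adj trmx_mul map_mxM. Qed.

Lemma adjD U V : adj (U + V) = adj U + adj V.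
Proof. by rewrite /adj linearD map_mxD. Qed.

Lemma adjZ c U : adj (c *: U) = c^* *: adj U.
Proof. by rewrite /adj linearZ map_mxZ. Qed.

Lemma adj1 : adj (1%:M : 'M[C]_(2 ^ n)) = 1%:M.
Proof. by rewrite /adj trmx1 map_mx1. Qed.

Lemma adjK U : adj (adj U) = U.
Proof. by apply/matrixP => r s; rewrite !mxE conjcK. Qed.

(** The Kronecker product of the 2 by 2 matrices [f j], written entrywise to match [pauli_op]. *)
Definition tens (f : 'I_n -> bool -> bool -> C) : 'M[C]_(2 ^ n) :=
  \matrix_(r, s) \prod_j f j (qbit j r) (qbit j s).

Lemma tensM f g :
  tens f *m tens g =
  tens (fun j b c => f j b true * g j true c + f j b false * g j false c).
Proof.
apply/matrixP => r s; rewrite !mxE.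
rewrite -(sum_prod_qbit (fun j b => f j (qbit j r) b * g j b (qbit j s))).
by apply: eq_bigr => t _; rewrite !mxE big_split.
Qed.

Lemma tens1 : tens (fun _ b c => (b == c)%:R) = 1%:M.
Proof. by apply/matrixP => r s; rewrite !mxE prod_eq_qbit. Qed.

Lemma pauli1E (a : 'I_4) b c :
  pauli1 R a b c = (c == b (+) pauli_flip a)%:R * 'i ^+ pauli_phase a b.
Proof.
have i3 : 'i ^+ 3 = - 'i :> C by rewrite exprS sqrCi mulrN1.
case: a => [[|[|[|[|a]]]] lta]; last by [].
all: case: b; case: c; rewrite /pauli1 /= ?mul0r ?mul1r //.
all: by rewrite ?sqrCi ?i3.
Qed.

Lemma pauli1_id b c : pauli1 R ord0 b c = (b == c)%:R.
Proof. by rewrite /pauli1 /=; case: (b == c). Qed.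

Lemma pauli1_Z b c : pauli1 R (inord 3) b c = (b == c)%:R * (-1) ^+ b.
Proof.
rewrite pauli1E inordK //; case: b; case: c;
  by rewrite /= ?mul0r // !mul1r ?sqrCi ?expr1 ?expr0.
Qed.

Lemma pauli1_mul (a b : 'I_4) : exists (k : nat) (c : 'I_4), forall r s,
  pauli1 R a r true * pauli1 R b true s + pauli1 R a r false * pauli1 R b false s
  = 'i ^+ k * pauli1 R c r s.
Proof.
have i4 : 'i ^+ 4 = 1 :> C by rewrite (exprM _ 2 2) sqrCi sqrrN expr1n.
(* With I, X, Y, Z labelled 0 to 3, the product up to phase is bitwise xor of labels. The phase [k]
   is read off at row [false]; [4 -] stands for negation mod 4. *)
pose c := Nat.lxor a b; pose k := (pauli_phase a false + pauli_phase b (pauli_flip a)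
  + (4 - pauli_phase c false))%N.
have [ltc flipc phc] : [/\ (c < 4)%N, pauli_flip c = pauli_flip a (+) pauli_flip b
    & forall r, pauli_phase a r + pauli_phase b (r (+) pauli_flip a)
                = k + pauli_phase c r %[mod 4]].
{ rewrite /k /c; case: a b {c k} => [[|[|[|[|a]]]] lta] [[|[|[|[|b]]]] ltb] //=.
  all: by split=> // r; case: r. }
exists k, (Ordinal ltc) => r s; rewrite !pauli1E /= flipc.
rewrite [RHS]mulrCA -exprD -(expr_mod (k + pauli_phase c r)%N i4) -phc expr_mod // exprD.
by case: r s (pauli_flip a) (pauli_flip b) => [] [] [] [];
  rewrite /= ?(mul0r, mul1r, mulr0, addr0, add0r).
Qed.

Lemma pauli1_sqr a b c :
  pauli1 R a b true * pauli1 R a true c + pauli1 R a b false * pauli1 R a false c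
  = (b == c)%:R.
Proof.
have i4 : 'i ^+ 4 = 1 :> C by rewrite (exprM _ 2 2) sqrCi sqrrN expr1n.
have e4 : 'i ^+ pauli_phase a b * 'i ^+ pauli_phase a (b (+) pauli_flip a) = 1 :> C.
  rewrite -exprD; case: a b => [[|[|[|[|a]]]] lta] [] //=.
rewrite !pauli1E; case: b c (pauli_flip a) e4 => [] [] [] /= e4;
  by rewrite ?(mul0r, mul1r, mulr0, addr0, add0r).
Qed.

Lemma adj_pauli1 a b c : (pauli1 R a b c)^* = pauli1 R a c b.
Proof.
rewrite !pauli1E rmorphM rmorph_nat rmorphXn /= conjCi.
have i3 : 'i ^+ 3 = - 'i :> C by rewrite exprS sqrCi mulrN1.
case: a => [[|[|[|[|a]]]] lta]; last by [].
all: case: b; case: c; rewrite /= ?mul0r ?mul1r ?expr0 ?expr1 ?sqrrN ?i3 //.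
by rewrite exprS sqrrN sqrCi mulrN1 opprK.
Qed.

(** A natural exponent instead of one in ['I_4] lets phases add freely. *)
Lemma pauliP P : pauli_group P <->
  exists (k : nat) (a : 'I_n -> 'I_4), P = 'i ^+ k *: tens (fun j => pauli1 R (a j)).
Proof.
split=> [[k [a ->]]|[k [a ->]]].
  by exists k, a; apply/matrixP => r s; rewrite !mxE.
have ltk : (k %% 4 < 4)%N by rewrite ltn_mod.
exists (Ordinal ltk), a; apply/matrixP => r s; rewrite !mxE /=; congr (_ * _).
by rewrite expr_mod // (exprM _ 2 2) sqrCi sqrrN expr1n.
Qed.

Lemma pauliM P Q : pauli_group P -> pauli_group Q -> pauli_group (P *m Q).
Proof.
move=> /pauliP[k [a ->]] /pauliP[l [b ->]]; apply/pauliP.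
have /choice[K /choice[c cE]] := fun j => pauli1_mul (a j) (b j).
exists (k + l + \sum_j K j)%N, c.
rewrite -scalemxAl -scalemxAr scalerA tensM -exprD [in RHS]exprD -scalerA; congr (_ *: _).
apply/matrixP => r s; rewrite !mxE expr_sum -big_split.
by apply: eq_bigr => j _; rewrite cE.
Qed.

Lemma pauliZi (k : nat) P : pauli_group P -> pauli_group ('i ^+ k *: P).
Proof.
by move=> /pauliP[l [a ->]]; apply/pauliP; exists (k + l)%N, a; rewrite scalerA exprD.
Qed.

Lemma pauliN P : pauli_group P -> pauli_group (- P).
Proof. by move=> /(pauliZi 2); rewrite sqrCi scaleN1r. Qed.

Lemma tens_pauli_sqr (a : 'I_n -> 'I_4) :
  tens (fun j => pauli1 R (a j)) *m tens (fun j => pauli1 R (a j)) = 1%:M.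
Proof.
rewrite tensM -tens1; apply/matrixP => r s; rewrite !mxE.
by apply: eq_bigr => j _; exact: pauli1_sqr.
Qed.

Lemma pauli_sqr P : pauli_group P -> P *m P = 1%:M \/ P *m P = - 1%:M.
Proof.
move=> /pauliP[k [a ->]].
rewrite -scalemxAl -scalemxAr scalerA tens_pauli_sqr -exprMn -expr2 sqrCi.
rewrite -signr_odd; case: odd; [right|left].
  by rewrite expr1 scaleN1r.
by rewrite expr0 scale1r.
Qed.

Lemma pauli_adj P : pauli_group P -> P *m adj P = 1%:M.
Proof.
move=> /pauliP[k [a ->]].
rewrite adjZ -scalemxAl -scalemxAr scalerA rmorphXn /= conjCi -exprMn mulrN -expr2 sqrCi.
rewrite opprK expr1n scale1r.
suff -> : adj (tens (fun j => pauli1 R (a j))) = tens (fun j => pauli1 R (a j)).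
  exact: tens_pauli_sqr.
apply/matrixP => r s; rewrite !mxE rmorph_prod.
by apply: eq_bigr => j _; exact: adj_pauli1.
Qed.

Lemma pauli_comm P Q : pauli_group P -> pauli_group Q ->
  P *m Q = Q *m P \/ P *m Q = - (Q *m P).
Proof.
move=> hP hQ.
(* [P], [Q] and [P *m Q] all square to a sign, so this identity relates [P *m Q] to [Q *m P] by a
   sign. *)
have E : P *m (P *m Q *m (P *m Q)) *m Q = (P *m P) *m (Q *m P) *m (Q *m Q).
  by rewrite !mulmxA.
have [|] := pauli_sqr (pauliM hP hQ); have [|] := pauli_sqr hP; have [|] := pauli_sqr hQ;
  move=> e1 e2 e3; move: E; rewrite e1 e2 e3 ?(mulmxN, mulNmx, mulmx1, mul1mx, opprK) => E;
  by [left; apply: oppr_inj | left | right | right; rewrite -E opprK].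
Qed.

Lemma pauli_adjN P : pauli_group P -> P *m P = - 1%:M -> adj P = - P.
Proof.
move=> hP PP; apply: oppr_inj; rewrite opprK -[RHS]mulmx1 -(pauli_adj hP) mulmxA PP.
by rewrite mulNmx mul1mx.
Qed.

(** * Diagonal Paulis and affine Boolean functions *)

Definition phase_diag (y : 'I_(2 ^ n) -> bool) : 'M[C]_(2 ^ n) :=
  diag_mx (\row_x (-1) ^+ y x).

(* Up to a sign [phase_diag y] is a product of [Z]'s exactly when [y] is an affine
   function of the bits over F_2. *)
Definition affine (y : 'I_(2 ^ n) -> bool) : Prop := pauli_group (phase_diag y).

Lemma affine_addb y z : affine y -> affine z -> affine (fun x => y x (+) z x).
Proof.
move=> hy hz; have := pauliM hy hz; rewrite /affine /phase_diag mulmx_diag.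
by congr (pauli_group (diag_mx _)); apply/rowP => x; rewrite !mxE signr_addb.
Qed.

Lemma affine_negb y : affine y -> affine (fun x => ~~ y x).
Proof.
move=> /pauliN; rewrite /affine /phase_diag -linearN.
by congr (pauli_group (diag_mx _)); apply/rowP => x; rewrite !mxE signrN.
Qed.

Lemma affine_qbit j : affine (qbit j).
Proof.
apply/pauliP; exists 0%N, (fun i => if i == j then inord 3 else ord0).
rewrite scale1r; apply/matrixP => r s; rewrite !mxE.
transitivity (\prod_i ((qbit i r == qbit i s)%:R * (if i == j then (-1) ^+ qbit j r else 1)) : C).
  by rewrite big_split prod_eq_qbit -big_mkcond big_pred1_eq /= mulr_natl.
apply: eq_bigr => i _; case: (i =P j) => [->|_]; first by rewrite pauli1_Z.
by rewrite pauli1_id mulr1.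
Qed.

Definition zero_index : 'I_(2 ^ n) := Ordinal (expn_gt0 2 n : (0 < 2 ^ n)%N).

Lemma qbit0 j : qbit j zero_index = false.
Proof. by rewrite /qbit /= div0n. Qed.

Lemma ket0E x : ket0 R n x 0 = (x == zero_index)%:R.
Proof. by rewrite mxE -val_eqE /=; case: (_ == _). Qed.

Lemma mulmx_ket0 P r : (P *m ket0 R n) r 0 = P r zero_index.
Proof.
rewrite mxE (bigD1 zero_index) //= ket0E eqxx mulr1 big1 ?addr0 // => s.
by rewrite ket0E => /negbTE->; rewrite mulr0.
Qed.

Lemma pauli_ket0 Q : pauli_group Q ->
  (exists l, Q *m ket0 R n = l *: ket0 R n) \/
  exists Z, [/\ pauli_group Z, Z *m ket0 R n = ket0 R n & Q *m Z = - (Z *m Q)].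
Proof.
move=> /pauliP[k [a ->]]; set Q' := _ *: _.
(* If [Q] flips some qubit [j], the Z on that qubit anticommutes with it; otherwise [Q] is
   diagonal. *)
case: (pickP (fun j => pauli_flip (a j))) => [j aj|na]; [right|left].
  exists (phase_diag (qbit j)); split; first exact: affine_qbit.
    apply/colP => r; rewrite mulmx_ket0 ket0E !mxE.
    by case: eqP => [->|_]; rewrite ?mulr0n // qbit0.
  apply/matrixP => r s; rewrite mul_mx_diag mxE [in RHS]mxE mul_diag_mx !mxE.
  rewrite (bigD1 j) //= pauli1E aj addbT.
  case: (qbit j r); case: (qbit j s); rewrite /= ?(mul0r, mulr0, oppr0) //.
    by rewrite expr0 expr1 mulr1 !mul1r mulN1r opprK.
  by rewrite expr0 expr1 mulrN1 !mul1r.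
exists (Q' zero_index zero_index); apply/colP => r; rewrite mulmx_ket0 [RHS]mxE ket0E.
have [->|ner] := eqVneq r zero_index; first by rewrite mulr1.
rewrite mulr0 !mxE.
case: (pickP (fun j => qbit j r)) => [j rj|r0].
  by rewrite (bigD1 j) //= pauli1E na rj qbit0 /= !mul0r mulr0.
by case/eqP: ner; apply: qbit_inj => j; rewrite qbit0 r0.
Qed.

(** * Clifford unitaries *)

Lemma cliffordM U V : clifford U -> clifford V -> clifford (U *m V).
Proof.
move=> [uU cU] [uV cV]; split=> [|P /cV/cU].
  by rewrite /unitary adjM mulmxA -(mulmxA U) uV mulmx1.
by rewrite adjM !mulmxA.
Qed.

(** Moving a Pauli [P] through [U] requires [adj U *m P *m U] to be a Pauli, whereas [clifford U]
    speaks only of conjugation the other way; both are carried along. *)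
Definition biclifford U := clifford U /\ clifford (adj U).

Lemma bicliffordM U V : biclifford U -> biclifford V -> biclifford (U *m V).
Proof.
move=> [cU cU'] [cV cV']; split; first exact: cliffordM.
by rewrite adjM; exact: cliffordM.
Qed.

Lemma biclifford1 : biclifford 1%:M.
Proof.
have c1 : clifford (1%:M : 'M[C]_(2 ^ n)).
  by split=> [|P]; rewrite ?/unitary adj1 ?mulmx1 // mul1mx.
by split; rewrite ?adj1.
Qed.

(** For [P] of square -1 this is the exponential of (pi/4) [P]. *)
Definition pauli_rot P : 'M[C]_(2 ^ n) := (sqrtC 2)^-1 *: (1%:M + P).

Lemma adj_pauli_rot P : pauli_group P -> P *m P = - 1%:M ->
  adj (pauli_rot P) = pauli_rot (- P).
Proof.
move=> hP PP; rewrite adjZ adjD adj1 (pauli_adjN hP PP); congr (_ *: _).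
by rewrite conj_Creal // rpredV ger0_real // sqrtC_ge0 ler0n.
Qed.

(** Conjugation by the rotation fixes the Paulis commuting with [P] and sends an anticommuting [Q]
    to [P *m Q]. *)
Lemma clifford_pauli_rot P : pauli_group P -> P *m P = - 1%:M -> clifford (pauli_rot P).
Proof.
move=> hP PP.
have c2 : (sqrtC 2)^-1 * (sqrtC 2)^-1 = 2^-1 :> C by rewrite -invfM -expr2 sqrtCK.
have half (A : 'M[C]_(2 ^ n)) : 2^-1 *: (A + A) = A.
  by rewrite -[A + A]mulr2n -[A *+ 2]scaler_nat scalerA mulVf ?scale1r // pnatr_eq0.
have rotN : (1%:M + P) *m (1%:M - P) = 1%:M + 1%:M.
  by rewrite mulmxDl mul1mx mulmxBr mulmx1 PP opprK addrA subrK.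
have rot2 : (1%:M + P) *m (1%:M + P) = P + P.
  by rewrite mulmxDl mul1mx mulmxDr mulmx1 PP (addrC _ P) addrACA subrr addr0.
split=> [|Q hQ].
  by rewrite /unitary adj_pauli_rot // -scalemxAl -scalemxAr scalerA c2 rotN half.
rewrite adj_pauli_rot // -!scalemxAl -scalemxAr scalerA c2.
have [PQ|PQ] := pauli_comm hP hQ.
  have -> : (1%:M + P) *m Q = Q *m (1%:M + P) by rewrite mulmxDl mulmxDr PQ mul1mx mulmx1.
  by rewrite -mulmxA rotN mulmxDr mulmx1 half.
have -> : (1%:M + P) *m Q *m (1%:M - P) = (1%:M + P) *m (1%:M + P) *m Q.
  rewrite -!mulmxA; congr (_ *m _).
  by rewrite mulmxDl mulmxBr PQ mul1mx mulmx1.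
by rewrite rot2 mulmxDl half; exact: pauliM.
Qed.

Lemma biclifford_pauli_rot P : pauli_group P -> P *m P = - 1%:M -> biclifford (pauli_rot P).
Proof.
move=> hP PP; split; first exact: clifford_pauli_rot.
rewrite adj_pauli_rot //; apply: clifford_pauli_rot; first exact: pauliN.
by rewrite mulmxN mulNmx opprK.
Qed.

Lemma pauli_rotE P (v : 'cV[C]_(2 ^ n)) : v + P *m v = sqrtC 2 *: (pauli_rot P *m v).
Proof.
rewrite -scalemxAl scalerA divff ?scale1r ?mulmxDl ?mul1mx //.
by rewrite sqrtC_eq0 pnatr_eq0.
Qed.

(** * Stabilizer states up to a scalar *)

(** The scalar may be 0, as [v + P *m v] vanishes when [P] maps [v] to its opposite. *)
Definition stabilizer_multiple (v : 'cV[C]_(2 ^ n)) : Prop :=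
  exists c U, biclifford U /\ v = c *: (U *m ket0 R n).

Lemma stabilizer_multipleZ c v : stabilizer_multiple v -> stabilizer_multiple (c *: v).
Proof. by move=> [d [U [cU ->]]]; exists (c * d), U; rewrite scalerA. Qed.

(* If [P ^+ 2 = -1] then [(1 + P) / sqrt 2] is Clifford. If [P ^+ 2 = 1], move [P]
   through [U] to get [Q]; unless [ket0] is an eigenvector of [Q], some [Z] fixing
   [ket0] anticommutes with [Q], so that [(1 + Q) ket0 = (1 + Q Z) ket0] where
   [(Q Z) ^+ 2 = -1]. *)
Lemma stabilizer_multiple_pauli P v : pauli_group P ->
  stabilizer_multiple v -> stabilizer_multiple (v + P *m v).
Proof.
move=> hP [c [U [bU ->]]].
have [PP|PP] := pauli_sqr hP; last first.
  rewrite pauli_rotE; apply: stabilizer_multipleZ; exists c, (pauli_rot P *m U).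
  split; first exact/bicliffordM/bU/biclifford_pauli_rot.
  by rewrite -scalemxAr mulmxA.
have uU : U *m adj U = 1%:M := bU.1.1.
have uU' : adj U *m U = 1%:M by have := bU.2.1; rewrite /unitary adjK.
pose Q := adj U *m P *m U.
have hQ : pauli_group Q by have := bU.2.2 _ hP; rewrite adjK.
have QQ : Q *m Q = 1%:M.
  by rewrite /Q !mulmxA -(mulmxA _ U) uU mulmx1 -(mulmxA (adj U) P) PP mulmx1.
have PU : P *m U = U *m Q by rewrite /Q !mulmxA uU mul1mx.
rewrite -scalemxAr mulmxA PU -mulmxA -scalerDr -mulmxDr.
apply: stabilizer_multipleZ.
have [[l ->]|[Z [hZ Z0 QZ]]] := pauli_ket0 hQ.
  by exists (1 + l), U; rewrite -[X in X + _]scale1r -scalerDl -scalemxAr.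
have hQZ := pauliM hQ hZ.
have QZ2 : (Q *m Z) *m (Q *m Z) = - 1%:M.
  have [ZZ|ZZ] := pauli_sqr hZ.
    by rewrite {1}QZ mulNmx -mulmxA (mulmxA Q) QQ mul1mx ZZ.
  (* Since [Z] fixes [ket0], its square cannot be -1. *)
  have : ket0 R n = - ket0 R n by rewrite -{1}Z0 -{1}Z0 mulmxA ZZ mulNmx mul1mx.
  move/matrixP/(_ zero_index 0)/eqP; rewrite [X in _ == X]mxE ket0E eqxx.
  by rewrite -addr_eq0 -(natrD _ 1 1) pnatr_eq0.
exists (sqrtC 2), (U *m pauli_rot (Q *m Z)); split.
  exact/(bicliffordM bU)/biclifford_pauli_rot.
by rewrite -mulmxA scalemxAr -pauli_rotE -(mulmxA Q Z) Z0.
Qed.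

(** Starting from [ket0], apply 1 + X to one qubit after another. *)
Lemma stabilizer_multiple_const1 : stabilizer_multiple (const_mx 1).
Proof.
pose g k (j : 'I_n) (b : bool) : C := ((j < k)%N || ~~ b)%:R.
(* [u k] is the indicator of the strings whose bits from position [k] on are all 0. *)
pose u k : 'cV[C]_(2 ^ n) := \col_x \prod_j g k j (qbit j x).
suff hu k : (k <= n)%N -> stabilizer_multiple (u k).
  have := hu n (leqnn n); congr stabilizer_multiple; apply/colP => x.
  by rewrite !mxE big1 // => j _; rewrite /g ltn_ord.
elim: k => [_|k IHk ltkn].
  exists 1, 1%:M; split; first exact: biclifford1.
  rewrite scale1r mul1mx; apply/colP => x; rewrite ket0E mxE -prod_eq_qbit.
  by apply: eq_bigr => j _; rewrite qbit0 eqbF_neg.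
pose j0 := Ordinal ltkn.
pose a (j : 'I_n) : 'I_4 := if j == j0 then inord 1 else ord0.
have hX : pauli_group (tens (fun j => pauli1 R (a j))).
  by apply/pauliP; exists 0%N, a; rewrite scale1r.
suff -> : u k.+1 = u k + tens (fun j => pauli1 R (a j)) *m u k.
  exact: stabilizer_multiple_pauli hX (IHk (ltnW ltkn)).
apply/colP => x; rewrite !mxE.
transitivity (\prod_j g k j (qbit j x) + \prod_j g k j (qbit j x (+) (j == j0))).
  rewrite !(bigD1 j0 (P := predT)) //= eqxx addbT.
  have -> : \prod_(j | j != j0) g k j (qbit j x (+) (j == j0))
          = \prod_(j | j != j0) g k j (qbit j x).
    by apply: eq_bigr => j /negbTE->; rewrite addbF.
  rewrite -mulrDl; congr (_ * _).
    by rewrite /g /= ltnS leqnn ltnn /= negbK; case: (qbit _ _); rewrite ?addr0 ?add0r.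
  apply: eq_bigr => j nej; rewrite /g ltnS leq_eqVlt.
  by rewrite (_ : (j == k :> nat) = false) //; apply/negbTE.
congr (_ + _).
transitivity (\sum_y \prod_j (pauli1 R (a j) (qbit j x) (qbit j y) * g k j (qbit j y))).
  rewrite (sum_prod_qbit (fun j b => pauli1 R (a j) (qbit j x) b * g k j b)).
  apply: eq_bigr => j _; rewrite !pauli1E /a.
  case: (j == j0); rewrite ?inordK //=; case: (qbit j x);
    by rewrite /= ?(mul0r, mul1r, mulr1, addr0, add0r).
by apply: eq_bigr => y _; rewrite !mxE big_split.
Qed.

(** * Pointwise multiplication of amplitudes *)

Definition stabilizer_multiplier (h : 'I_(2 ^ n) -> C) : Prop :=
  forall v, stabilizer_multiple v -> stabilizer_multiple (\col_x (h x * v x 0)).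

Lemma stabilizer_multiplierC c : stabilizer_multiplier (fun=> c).
Proof.
move=> v /(stabilizer_multipleZ c); congr stabilizer_multiple.
by apply/colP => x; rewrite !mxE.
Qed.

Lemma stabilizer_multiplierM g h : stabilizer_multiplier g -> stabilizer_multiplier h ->
  stabilizer_multiplier (fun x => g x * h x).
Proof.
move=> hg hh v /hh/hg; congr stabilizer_multiple.
by apply/colP => x; rewrite !mxE mulrA.
Qed.

(** Multiplying by this function is [v + P *m v] for the diagonal Pauli [P] with entries
    ['i ^+ k * (-1) ^+ y x]. *)
Lemma stabilizer_multiplier_phase (k : nat) y : affine y ->
  stabilizer_multiplier (fun x => 1 + 'i ^+ k * (-1) ^+ y x).
Proof.
move=> /(pauliZi k) hP v /(stabilizer_multiple_pauli hP); congr stabilizer_multiple.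
by apply/colP => x; rewrite -scalemxAl mul_diag_mx !mxE mulrDl mul1r mulrA.
Qed.

Lemma stabilizer_multiplier_i y : affine y ->
  stabilizer_multiplier (fun x => 'i ^+ y x).
Proof.
(* As i^3 = -i, the factor is 1 - i or 1 + i; scaling by (1 + i)/2 turns these into 1 and i. *)
move=> /(stabilizer_multiplier_phase 3).
move/(stabilizer_multiplierM (stabilizer_multiplierC ((1 + 'i) / 2))).
congr stabilizer_multiplier; apply/funext => x.
have i2 : 'i ^+ 2 = -1 :> C := sqrCi C.
by case: (y x); rewrite ?expr0 ?expr1; field: i2.
Qed.

Lemma stabilizer_multiplier_bool y : affine y ->
  stabilizer_multiplier (fun x => (y x)%:R).
Proof.
(* As i^2 = -1, the factor is 0 or 2. *)
move=> /(stabilizer_multiplier_phase 2).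
move/(stabilizer_multiplierM (stabilizer_multiplierC (2^-1))).
congr stabilizer_multiplier; apply/funext => x; rewrite sqrCi.
by case: (y x); rewrite /= ?expr0 ?expr1; field.
Qed.

(** * Sums of multipliers and stabilizer rank *)

(** The terms are multipliers, not states, so that decompositions can be multiplied; an arbitrary
    finite index type makes sums and products of them sum and product types. *)
Definition stabilizer_span (k : nat) (h : 'I_(2 ^ n) -> C) : Prop :=
  exists (I : finType) (F : I -> 'I_(2 ^ n) -> C),
    [/\ #|I| = k, forall i, stabilizer_multiplier (F i) & forall x, h x = \sum_i F i x].

Lemma stabilizer_span1 h : stabilizer_multiplier h -> stabilizer_span 1 h.
Proof.
move=> hh; exists unit, (fun=> h); split=> [|//|x]; first exact: card_unit.
by rewrite big_const card_unit /= addr0.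
Qed.

Lemma stabilizer_spanD k l g h : stabilizer_span k g -> stabilizer_span l h ->
  stabilizer_span (k + l) (fun x => g x + h x).
Proof.
move=> [I [F [cI hF gE]]] [J [G [cJ hG hE]]].
exists (I + J)%type, (fun s => match s with inl i => F i | inr j => G j end).
split=> [|[]//|x]; first by rewrite card_sum cI cJ.
by rewrite big_sumType gE hE.
Qed.

Lemma stabilizer_spanM k l g h : stabilizer_span k g -> stabilizer_span l h ->
  stabilizer_span (k * l) (fun x => g x * h x).
Proof.
move=> [I [F [cI hF gE]]] [J [G [cJ hG hE]]].
exists (I * J)%type, (fun s x => F s.1 x * G s.2 x).
split=> [|s|x]; [by rewrite card_prod cI cJ | exact: stabilizer_multiplierM |].
by rewrite gE hE big_distrlr pair_bigA.
Qed.

Lemma stabilizer_spanZ k c h : stabilizer_span k h -> stabilizer_span k (fun x => c * h x).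
Proof.
move=> hh; rewrite -[k]mul1n; apply: stabilizer_spanM => //.
exact/stabilizer_span1/stabilizer_multiplierC.
Qed.

Lemma stab_rank_le_span k h : stabilizer_span k h ->
  (stab_rank (\col_x h x) <= k)%N.
Proof.
move=> [I [F [cI hF hE]]].
have dec : stab_decomp (\col_x h x) k.
  (* Each multiplier acts on the all-ones vector. *)
  have hs i : stabilizer_multiple (\col_x F i x).
    have := hF i _ stabilizer_multiple_const1; congr stabilizer_multiple.
    by apply/colP => x; rewrite !mxE mulr1.
  have /choice[c /choice[U cU]] := hs.
  rewrite -{}cI; exists (c \o enum_val), (fun i => U (enum_val i) *m ket0 R n).
  split=> [i|]; first by exists (U (enum_val i)); split=> //; exact: (cU _).1.1.
  rewrite -(big_enum_val (fun i => c i *: (U i *m ket0 R n))) /=.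
  apply/colP => x; rewrite mxE hE summxE; apply: eq_bigr => i _.
  by rewrite -(cU i).2 mxE.
rewrite /stab_rank; case: pselect => // ex; case: ex_minnP => l _; apply.
exact/asboolP.
Qed.

Lemma affine_false : affine (fun=> false).
Proof.
apply/pauliP; exists 0%N, (fun=> ord0); rewrite scale1r.
transitivity (1%:M : 'M[C]_(2 ^ n)); first by apply/matrixP => r s; rewrite !mxE.
rewrite -tens1; apply/matrixP => r s; rewrite !mxE.
by apply: eq_bigr => j _; rewrite pauli1_id.
Qed.

(** For a bit y, w^y = (1 - y) + w y. *)
Lemma stabilizer_span_bit w y : affine y -> stabilizer_span 2 (fun x => w ^+ y x).
Proof.
move=> hy.
have h0 := stabilizer_span1 (stabilizer_multiplier_bool (affine_negb hy)).
have h1 := stabilizer_spanZ w (stabilizer_span1 (stabilizer_multiplier_bool hy)).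
have := stabilizer_spanD h0 h1; congr (stabilizer_span 2); apply/funext => x.
by case: (y x); rewrite /= ?add0r ?mulr1 ?mulr0 ?addr0.
Qed.

Lemma stabilizer_multiplier_prod (I : Type) (s : seq I) (F : I -> 'I_(2 ^ n) -> C) :
  (forall i, stabilizer_multiplier (F i)) ->
  stabilizer_multiplier (fun x => \prod_(i <- s) F i x).
Proof.
move=> hF; elim: s => [|i s IHs].
  have := stabilizer_multiplierC 1; congr stabilizer_multiplier.
  by apply/funext => x; rewrite big_nil.
have := stabilizer_multiplierM (hF i) IHs; congr stabilizer_multiplier.
by apply/funext => x; rewrite big_cons.
Qed.

Lemma stabilizer_span_even6 w (y : 'I_6 -> 'I_(2 ^ n) -> bool) :
  (forall i, affine (y i)) -> (forall x, \big[addb/false]_i y i x = false) ->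
  stabilizer_span 4 (fun x => \prod_i w ^+ y i x).
Proof.
move=> hy y_even.
have h0 := stabilizer_span1 (stabilizer_multiplierC ((w ^+ 2 + w ^+ 4) / 2)).
have span_prod c F : (forall i, stabilizer_multiplier (F i)) ->
    stabilizer_span 1 (fun x => c * \prod_(i < 6) F i x).
  by move=> hF; exact/stabilizer_spanZ/stabilizer_span1/stabilizer_multiplier_prod.
have h1 := span_prod ((w ^+ 4 - w ^+ 2) / 2) _ (fun i => stabilizer_multiplier_i (hy i)).
have h2 := span_prod (1 - w ^+ 4) _
  (fun i => stabilizer_multiplier_bool (affine_negb (hy i))).
have h3 := span_prod (w ^+ 6 - w ^+ 2) _ (fun i => stabilizer_multiplier_bool (hy i)).
have := stabilizer_spanD (stabilizer_spanD (stabilizer_spanD h0 h1) h2) h3.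
congr (stabilizer_span 4); apply/funext => x.
exact: exp_even6 w (y^~ x) (y_even x).
Qed.

End Paulis.

(** * Decomposition of the product state in blocks of four qubits *)

Section ProductState.
Variables (m : nat) (w : C).
Hypothesis w_neq0 : w != 0.

(** A version of [qbit] with a natural index, so that positions [4 * q + i] carry no bound. *)
Definition bit (j : nat) (x : 'I_(2 ^ m)) : bool := odd (x %/ 2 ^ j).

Lemma affine_bit j : (j < m)%N -> affine (bit j).
Proof. by move=> ltjm; exact: affine_qbit (Ordinal ltjm). Qed.

(* [p] is the outgoing parity bit of the last block. *)
Lemma stabilizer_span_blocks q : (4 * q <= m)%N -> exists p, affine p /\
  stabilizer_span (4 ^ q) (fun x => (\prod_(0 <= j < 4 * q) w ^+ bit j x) * w ^+ p x).
Proof.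
elim: q => [_|q IHq ltqm].
  (* Before any block the outgoing bit is 0, so the first incoming bit is 1. *)
  exists (fun=> false); split; first exact: affine_false.
  apply: stabilizer_span1; have := stabilizer_multiplierC (n := m) 1.
  by congr stabilizer_multiplier; apply/funext => x; rewrite muln0 big_geq // mulr1.
have [|p [hp sp]] := IHq; first by apply: leq_trans ltqm; rewrite leq_mul2l leqnSn orbT.
have hb i : (i < 4)%N -> affine (bit (4 * q + i)).
  by move=> lti; apply: affine_bit; apply: leq_trans ltqm; rewrite mulnS addnC ltn_add2r.
(* The parity of the incoming bit and the four block bits, which makes the six bits even. *)
pose p' x := ~~ p x (+) bit (4 * q + 0) x (+) bit (4 * q + 1) x (+) bit (4 * q + 2) x
             (+) bit (4 * q + 3) x.
have hp' : affine p' by do 4 (apply: affine_addb; last exact: hb); exact: affine_negb.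
pose y (i : 'I_6) (x : 'I_(2 ^ m)) :=
  nth false [:: ~~ p x; bit (4 * q + 0) x; bit (4 * q + 1) x; bit (4 * q + 2) x;
                bit (4 * q + 3) x; p' x] i.
have hy i : affine (y i).
  by case: i => [[|[|[|[|[|[|i]]]]]] lti] //; [exact: affine_negb | exact: hb ..].
have y_even x : \big[addb/false]_i y i x = false.
  rewrite !big_ord_recl big_ord0 /y /= /p'.
  by case: (p x); do 4 case: (bit _ x).
exists p'; split=> //; rewrite expnSr.
(* The factor [w^-1] cancels the joint contribution [w] of [p] and its negation. *)
have := stabilizer_spanZ w^-1 (stabilizer_spanM sp (stabilizer_span_even6 w hy y_even)).
congr stabilizer_span; apply/funext => x.
have -> : \prod_(0 <= j < 4 * q.+1) w ^+ bit j x =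
          (\prod_(0 <= j < 4 * q) w ^+ bit j x) * \prod_(i < 4) w ^+ bit (4 * q + i) x.
  rewrite mulnSr (big_cat_nat (n := 4 * q)) ?leq_addr //=; congr (_ * _).
  rewrite -{1}[(4 * q)%N]add0n big_addn addKn big_mkord.
  by apply: eq_bigr => i _; rewrite addnC.
rewrite !big_ord_recl !big_ord0 /y /=.
have wp : w ^+ p x * w ^+ (~~ p x) = w by case: (p x); rewrite ?mulr1 ?mul1r.
by rewrite !mulr1 !mulrA -(mulrA (w^-1 * _) (w ^+ p x)) wp (mulrC w^-1) mulfVK.
Qed.

(* The parity bit left by the blocks and each of the [m %% 4 <= 3] remaining qubits
   cost a factor 2. *)
Lemma stabilizer_span_powers : exists k, (k <= 16 * 4 ^ (m %/ 4))%N /\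
  stabilizer_span k (fun x => \prod_(j < m) w ^+ bit j x).
Proof.
have le_blocks : (4 * (m %/ 4) <= m)%N by rewrite mulnC leq_divM.
have [p [hp sp]] := stabilizer_span_blocks le_blocks.
suff span_rest r : (4 * (m %/ 4) + r <= m)%N ->
    stabilizer_span (4 ^ (m %/ 4) * 2 * 2 ^ r)
      (fun x => \prod_(0 <= j < 4 * (m %/ 4) + r) w ^+ bit j x).
  exists (4 ^ (m %/ 4) * 2 * 2 ^ (m %% 4))%N; split.
    rewrite -mulnA -expnS mulnC leq_mul2r; apply/orP; right.
    by rewrite (leq_pexp2l (m := 2) (n2 := 4)) // ltn_mod.
  have em : (4 * (m %/ 4) + m %% 4 = m)%N by rewrite mulnC -divn_eq.
  have := span_rest (m %% 4)%N; rewrite em leqnn => /(_ isT).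
  by congr stabilizer_span; apply/funext => x; rewrite big_mkord.
elim: r => [_|r IHr ler].
  (* Multiplying by [w^-1 ^+ p x] removes the leftover parity factor. *)
  have := stabilizer_spanM sp (stabilizer_span_bit w^-1 hp).
  rewrite addn0 expn0 muln1; congr stabilizer_span; apply/funext => x.
  by case: (p x); rewrite ?expr0 ?expr1 ?mulr1 // mulfK.
rewrite addnS in ler *.
have := stabilizer_spanM (IHr (ltnW ler)) (stabilizer_span_bit w (affine_bit ler)).
rewrite -mulnA -expnSr; congr stabilizer_span; apply/funext => x.
by rewrite big_nat_recr.
Qed.

End ProductState.

(** * The rank bound and its asymptotic form *)

Lemma stab_rank_Rtheta (theta : R) (m : nat) :
  (stab_rank (Rtheta_pow theta m) <= 16 * 4 ^ (m %/ 4))%N.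
Proof.
pose w : C := (cos theta +i* sin theta)%C.
have w_neq0 : w != 0.
  apply/eqP => -[c0 s0]; have := cos2Dsin2 theta.
  by rewrite c0 s0 expr0n addr0 => /esym/eqP; rewrite oner_eq0.
have [k [lek sk]] := stabilizer_span_powers m w_neq0.
apply: leq_trans lek.
have := stab_rank_le_span (stabilizer_spanZ (((Num.sqrt 2)^-1)%:C%C ^+ m) sk).
congr (stab_rank _ <= k)%N; apply/colP => x; rewrite !mxE.
rewrite -[X in _ ^+ X * _]card_ord -prodr_const -big_split.
by apply: eq_bigr => j _; rewrite /Rtheta1 /bit -/(qbit j x); case: (qbit j x).
Qed.

End Rank.

(* chi(R_theta^{(x) m}) = O(2^{m/2}) as m -> oo, for every theta *)
Theorem theorem2 (R : realType) (theta : R) :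
  exists (K : R) (N : nat), forall m : nat, (N <= m)%N ->
    ((stab_rank (Rtheta_pow theta m))%:R : R) <= K * Num.sqrt 2 ^+ m.
Proof.
exists 16, 0%N => m _.
have le_rank : ((stab_rank (Rtheta_pow theta m))%:R : R) <= (16 * 4 ^ (m %/ 4))%:R.
  by rewrite ler_nat; exact: stab_rank_Rtheta.
apply: (Order.POrderTheory.le_trans le_rank).
rewrite natrM natrX ler_pM2l ?ltr0n //.
(* This turns 4^(m %/ 4) into a power of sqrt 2 with exponent at most [m]; as sqrt 2 is at least 1,
   it is bounded by the power [m]. *)
have <- : Num.sqrt 2 ^+ 4 = 4 :> R by rewrite (exprM _ 2 2) sqr_sqrtr ?ler0n // -natrX.
rewrite -exprM mulnC; apply: ler_weXn2l; last exact: leq_divM.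
by rewrite -[X in X <= _]sqrtr1 ler_sqrt ?ltr0n // ler1n.
Qed.
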